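(* Let $\mathbf{n}=(n_1,n_2)$ with $n_1,n_2$ positive integers. Let $\mu_3(\mathbf{n})$ denote the maximum size of a subset $S\subseteq [n_1]\times[n_2]$ such that there are no elements $\mathbf{a}_1,\mathbf{a}_2,\mathbf{a}_3\in S$ (not necessarily distinct) with $\mathbf{a}_1+\mathbf{a}_2+\mathbf{a}_3=\mathbf{n}$. Then, as both $n_1$ and $n_2$ go to infinity, \[\mu_3(\mathbf{n})\le \frac{7}{9}\,n_1n_2+O\big(\max\{n_1,n_2\}\big).\]
   Context: For a positive integer $n$, $[n]=\{1,\ldots,n\}$. Addition of lattice points is coordinatewise. *)

(* Defs.v *)
From mathcomp Require Import all_boot all_order all_algebra.

Set Implicit Arguments.
Unset Strict Implicit.
Unset Printing Implicit Defensive.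

(* Elements of 'I_n.+1 are 0, ..., n, so [n] is the set of nonzero ones. *)
Definition grid (n1 n2 : nat) : {set 'I_n1.+1 * 'I_n2.+1} :=
  [set a : 'I_n1.+1 * 'I_n2.+1 | (0 < a.1) && (0 < a.2)].

(* The sums are taken in nat, not modulo n_i + 1. *)
Definition sum3_free (n1 n2 : nat) (S : {set 'I_n1.+1 * 'I_n2.+1}) : bool :=
  ~~ [exists a1 in S, exists a2 in S, exists a3 in S,
       (nat_of_ord a1.1 + nat_of_ord a2.1 + nat_of_ord a3.1 == n1)%N &&
       (nat_of_ord a1.2 + nat_of_ord a2.2 + nat_of_ord a3.2 == n2)%N].

Definition mu3 (n1 n2 : nat) : nat :=
  \max_(S : {set 'I_n1.+1 * 'I_n2.+1} | (S \subset grid n1 n2) && sum3_free S)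
     #|S|.

(* Main.v *)
(** Write N x P for the grid and rescale it to the unit square.  If (x, y) is
    in the set, then b |-> (1, 1) - (x, y) - b pairs points of the rectangle
    [0, 1 - x] x [0, 1 - y], so the complement has area at least
    (1 - x)(1 - y)/2 plus the area missing from the columns beyond 1 - x.  If
    x, y <= 1/3 this is already 2/9.  For 1/3 < x < 2/3 let k(x) be the amount
    by which the lowest point of column x lies below the line x + y = 2/3.  If
    the complement had area less than 2/9, the bound at that lowest point would
    read (1 - x) k(x) < 2 \int_(1-x)^(2/3) k whenever k(x) > 0.  Integrating
    against the weight x - 1/3 makes both sides equal, hence k = 0.  By symmetry
    the same holds for rows, so the whole triangle x + y < 2/3, of area 2/9, is
    missing. *)

Require Import Defs.
From mathcomp Require Import all_boot all_order all_algebra.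
From mathcomp Require Import zify ring lra.
Import Order.TTheory GRing.Theory Num.Theory.
Local Open Scope ring_scope.
Set Implicit Arguments.
Unset Strict Implicit.
Unset Printing Implicit Defensive.
Local Open Scope nat_scope.

(** * Point sets as relations, and the gaps at the bottom of columns *)

Definition sum3_free_rel (N P : nat) (s : rel nat) : Prop :=
  forall x1 y1 x2 y2 x3 y3, s x1 y1 -> s x2 y2 -> s x3 y3 ->
    x1 + x2 + x3 = N -> y1 + y2 + y3 = P -> False.

Definition col_missing (P : nat) (s : rel nat) (x : nat) : nat :=
  \sum_(1 <= y < P.+1) ~~ s x y.

Definition missing (N P : nat) (s : rel nat) : nat :=
  \sum_(1 <= x < N.+1) col_missing P s x.

(** On an empty column [find] returns [P]; otherwise the lowest point has height one more than the
    gap. *)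
Definition col_gap (P : nat) (s : rel nat) (x : nat) : nat :=
  find (s x) (iota 1 P).

Definition transpose_rel (s : rel nat) : rel nat := fun x y => s y x.

Lemma missing_transpose N P s :
  missing P N (transpose_rel s) = missing N P s.
Proof. by rewrite /missing /col_missing exchange_big. Qed.

Lemma sum3_free_rel_transpose N P s :
  sum3_free_rel N P s -> sum3_free_rel P N (transpose_rel s).
Proof.
move=> sF x1 y1 x2 y2 x3 y3 s1 s2 s3 e1 e2.
exact: sF s1 s2 s3 e2 e1.
Qed.

Lemma leq_col_missing P s x g :
  g <= P -> (forall y, 1 <= y <= g -> ~~ s x y) -> g <= col_missing P s x.
Proof.
move=> gP gs; rewrite /col_missing (@big_cat_nat _ _ _ g.+1) //=.
apply: leq_trans (leq_addr _ _).
rewrite (eq_big_nat _ _ (F2 := fun=> 1)) => [|y yg]; last by rewrite gs.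
by rewrite sum_nat_const_nat; lia.
Qed.

Lemma col_gap_le P s x : col_gap P s x <= P.
Proof. by rewrite -[leqRHS](size_iota 1) find_size. Qed.

Lemma notin_col_gap P s x y : 1 <= y <= col_gap P s x -> ~~ s x y.
Proof.
move=> yg; have gP := col_gap_le P s x.
have /(before_find 0) : y.-1 < col_gap P s x by lia.
by rewrite nth_iota; [rewrite add1n prednK; [move->|lia]|lia].
Qed.

Lemma col_gap_in P s x : col_gap P s x < P -> s x (col_gap P s x).+1.
Proof.
move=> gP; have hs : has (s x) (iota 1 P) by rewrite has_find size_iota.
by have := nth_find 0 hs; rewrite nth_iota.
Qed.

Lemma col_gap_le_missing P s x : col_gap P s x <= col_missing P s x.
Proof. exact: leq_col_missing (col_gap_le _ _ _) (@notin_col_gap _ _ _). Qed.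

(* The involution b |-> (N, P) - a - b of the rectangle below (N, P) - a maps
   points of s to missing points. *)
Lemma missing_ge N P s x y :
  sum3_free_rel N P s -> s x y -> 1 <= x < N ->
  (N - x - 1) * (P - y - 1) + 2 * (\sum_(N - x <= z < N.+1) col_missing P s z)
  <= 2 * missing N P s.
Proof.
move=> sF sxy xN.
rewrite /missing (@big_cat_nat _ _ _ (N - x) 1) /=; [|lia..].
rewrite mulnDr leq_add2r mul2n -addnn.
(* Reversing one of the two copies pairs column [z] with column [N - x - z]. *)
rewrite {2}big_nat_rev -big_split /=.
have <- : \sum_(1 <= z < N - x) (P - y - 1) = (N - x - 1) * (P - y - 1).
  by rewrite sum_nat_const_nat.
rewrite big_nat [leqRHS]big_nat; apply: leq_sum => z zN.
have trunc w : \sum_(1 <= t < P - y) ~~ s w t <= col_missing P s w.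
  have [yP|Py] := leqP 1 (P - y); last by rewrite big_geq //; lia.
  rewrite /col_missing [leqRHS](@big_cat_nat _ _ _ (P - y)) ?leq_addr //.
  by lia.
apply: leq_trans (leq_add (trunc _) (trunc _)).
rewrite [X in _ + X]big_nat_rev -big_split /=.
rewrite -[leqLHS]muln1 -sum_nat_const_nat.
rewrite big_nat [leqRHS]big_nat; apply: leq_sum => t tP.
case s1: (s z t) => //=; case s2: (s _ _) => //=.
by case: (sF _ _ _ _ _ _ sxy s1 s2); lia.
Qed.

(** * Sums over the middle third *)

(* third_lo N <= x < third_hi N means N < 3x <= 2N - 2. *)
Definition third_lo (N : nat) : nat := (N %/ 3).+1.
Definition third_hi (N : nat) : nat := N.*2.+1 %/ 3.

(** A left Riemann sum against the integral (2N - 3u)^2 / 6, with the term [z = u] set apart. *)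
Lemma sum_decr_ge N u :
  3 * u <= 2 * N ->
  (2 * N - 3 * u) ^ 2 <=
  6 * (\sum_(u.+1 <= z < third_hi N) (2 * N - 3 * z)) + 6 * (2 * N - 3 * u).
Proof.
move: {2}(third_hi N - u) (leqnn (third_hi N - u)) => d.
elim: d u => [|d IH] u ud uN.
  by rewrite big_geq; rewrite /third_hi in ud *; nia.
have [hu|uh] := leqP (third_hi N) u.+1.
  by rewrite big_geq //; rewrite /third_hi in hu; nia.
have uN' : 3 * u.+1 <= 2 * N by rewrite /third_hi in uh; lia.
have := IH u.+1 ltac:(lia) uN'.
by rewrite (big_ltn uh); move: (\sum_(_ <= _ < _) _) => S; nia.
Qed.

Lemma sum_incr_le N u :
  N <= 3 * u -> u < third_hi N ->
  6 * (\sum_(u.+1 <= z < third_hi N) (3 * z - N)) + (3 * u - N) ^ 2 <= N ^ 2.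
Proof.
move=> Nu uh.
(* The extra term makes the step from [u.+1] to [u] an identity. The base case fits under N^2
   because the largest [z] has 3z - N <= N - 2. *)
suff : 6 * (\sum_(u.+1 <= z < third_hi N) (3 * z - N)) + (3 * u - N) ^ 2
         + 3 * (3 * u - N) <= N ^ 2 by lia.
move: {2}(third_hi N - u) (leqnn (third_hi N - u)) => d.
elim: d u Nu uh => [|d IH] u Nu uh ud; first by lia.
have [hu|uh'] := leqP (third_hi N) u.+1.
  by rewrite big_geq //; rewrite /third_hi in uh; nia.
have := IH u.+1 ltac:(lia) uh' ltac:(lia).
by rewrite (big_ltn uh'); move: (\sum_(_ <= _ < _) _) => S; nia.
Qed.

(* The weight 3x - N is a fixed point of the adjoint of the operator on the
   right-hand side of the hypothesis, up to an error of favourable sign. *)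
Lemma third_eq0 N (K : nat -> nat) :
  (forall x, third_lo N <= x < third_hi N -> 0 < K x ->
     (N - x) * K x < 2 * \sum_(third_lo N <= z < third_hi N | N < x + z) K z) ->
  forall x, third_lo N <= x < third_hi N -> K x = 0.
Proof.
move=> HK.
set lo := third_lo N; set hi := third_hi N.
pose q x := 3 * x - N.
(* The summand [0 < K x] records the strictness of the hypothesis. *)
have H1 : \sum_(lo <= x < hi) q x * ((N - x) * K x + (0 < K x)) <=
    \sum_(lo <= x < hi) q x * (2 * \sum_(lo <= z < hi | N < x + z) K z).
  rewrite big_nat [leqRHS]big_nat; apply: leq_sum => x xA.
  apply: leq_mul => //; case: (posnP (K x)) => [->|K0].
    by rewrite muln0.
  by rewrite addn1; apply: HK.
have H2 : \sum_(lo <= x < hi) q x * (2 * \sum_(lo <= z < hi | N < x + z) K z)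
    <= \sum_(lo <= z < hi) q z * ((N - z) * K z).
  have -> : \sum_(lo <= x < hi) q x * (2 * \sum_(lo <= z < hi | N < x + z) K z)
      = \sum_(lo <= z < hi) K z * (2 * \sum_(lo <= x < hi | N < x + z) q x).
    under eq_bigr do rewrite mulnCA big_distrr /=.
    under [RHS]eq_bigr do rewrite mulnCA big_distrr /=.
    rewrite -!big_distrr /=; congr (2 * _).
    rewrite (exchange_big_dep_nat xpredT) //=.
    by apply: eq_bigr => z _; apply: eq_bigr => x _; rewrite mulnC.
  rewrite big_nat [leqRHS]big_nat; apply: leq_sum => z zA.
  rewrite [leqRHS]mulnA [leqRHS]mulnC; apply: leq_mul => //.
  have zN : 3 * z + 2 <= 2 * N by rewrite /hi /third_hi in zA; lia.
  have Nz : N < 3 * z by rewrite /lo /third_lo in zA; lia.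
  have -> : \sum_(lo <= x < hi | N < x + z) q x =
            \sum_((N - z).+1 <= x < hi) q x.
    rewrite [RHS](big_nat_widenl _ lo); last by rewrite /lo /third_lo; lia.
    by apply: eq_bigl => x /=; lia.
  have [hu|uh] := leqP hi (N - z); first by rewrite big_geq //; lia.
  (* As N^2 - (2N - 3z)^2 = 3 (3z - N) (N - z), the sum of [q] is at most half of
     [q z * (N - z)]. *)
  have := @sum_incr_le N (N - z) ltac:(lia) uh.
  rewrite -/hi /q; move: (\sum_(_ <= _ < _) _) => S; nia.
have := leq_trans H1 H2.
under eq_bigr do rewrite mulnDr.
rewrite big_split /= -[leqRHS]addn0 leq_add2l leqn0 => H0 x xA.
move: H0; rewrite sum_nat_seq_eq0 => /allP/(_ x).
rewrite mem_index_iota xA => /(_ isT) /=; rewrite muln_eq0 /q.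
by rewrite /lo /third_lo in xA; case: (K x) => //= k; lia.
Qed.

(** * The deficit inequality for a small complement *)

(* 3N times the height of the line x/N + y/P = 2/3 above the gap of column x,
   truncated at 0. *)
Definition deficit (N P : nat) (s : rel nat) (x : nat) : nat :=
  2 * N * P - (3 * P * x + 3 * N * col_gap P s x).

Lemma deficit_arith N P x h S c D m :
  N < 3 * x -> 3 * x + 2 <= 2 * N -> h < P ->
  P * S <= 3 * N * c + D -> 9 * m + 18 * maxn N P < 2 * (N * P) ->
  (3 * x - N) ^ 2 <= 6 * S + 6 * (3 * x - N) ->
  (N - x - 1) * (P - h.+1 - 1) + 2 * c <= 2 * m ->
  0 < 2 * N * P - (3 * P * x + 3 * N * h) ->
  (N - x) * (2 * N * P - (3 * P * x + 3 * N * h)) < 2 * D.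
Proof.
move=> Nx xN hP; have [a Na] : exists a, N = x + a by exists (N - x); lia.
have [b Pb] : exists b, P = h + b by exists (P - h); lia.
have [t Et] : exists t, 3 * x = N + t by exists (3 * x - N); lia.
have -> : N - x = a by lia.
have -> : P - h.+1 - 1 = b - 2 by lia.
have -> : 3 * x - N = t by lia.
move: (maxn N P) (leq_maxl N P) (leq_maxr N P) => M NM PM H few dec miss K0.
have [K EK] : exists K, 2 * N * P = 3 * P * x + 3 * N * h + K.
  by exists (2 * N * P - (3 * P * x + 3 * N * h)); lia.
have -> : 2 * N * P - (3 * P * x + 3 * N * h) = K by lia.
have ab : a * b <= (a - 1) * (b - 2) + 2 * a + b by nia.
have e1 : N * (a * b + 2 * c) <= N * (2 * m + 2 * N + P).
  by rewrite leq_mul2l; apply/orP; right; lia.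
have e2 : N * (9 * m + 18 * M).+1 <= N * (2 * (N * P)).
  by rewrite leq_mul2l few orbT.
have e3 : P * t ^ 2 <= P * (6 * S + 6 * t) by rewrite leq_mul2l dec orbT.
have e4 : P * t <= P * N by rewrite leq_mul2l; apply/orP; right; lia.
(* The rounding errors, 18 N N + 15 N P in total, are absorbed by the 36 N M in twice [e2]. *)
have e5 : N * (N + P) <= N * (2 * M).
  by rewrite leq_mul2l; apply/orP; right; lia.
(* With u = x / N, this is 3 (1 - u) (1 + 3 u) + (3 u - 1)^2 = 4. *)
have e7 : 9 * (N * (a * b)) + P * t ^ 2 = 4 * (N * (N * P)) + 3 * (a * K).
  apply/eqP; rewrite -eqz_nat -mulnn !(PoszD, PoszM); apply/eqP.
  have -> : K%:Z = (2 * N%:Z * P%:Z - 3 * P%:Z * x%:Z - 3 * N%:Z * h%:Z)%R.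
    by lia.
  have -> : t%:Z = (3 * x%:Z - N%:Z)%R by lia.
  have -> : a%:Z = (N%:Z - x%:Z)%R by lia.
  have -> : b%:Z = (P%:Z - h%:Z)%R by lia.
  by ring.
by lia.
Qed.

Lemma deficit_lt N P s x :
  sum3_free_rel N P s -> 9 * missing N P s + 18 * maxn N P < 2 * (N * P) ->
  third_lo N <= x < third_hi N -> 0 < deficit N P s x ->
  (N - x) * deficit N P s x <
    2 * \sum_(third_lo N <= z < third_hi N | N < x + z) deficit N P s z.
Proof.
move=> sF few xA.
have Nx : N < 3 * x by rewrite /third_lo in xA; lia.
have xN : 3 * x + 2 <= 2 * N by rewrite /third_hi in xA; lia.
rewrite {1 2}/deficit; set h := col_gap P s x => K0.
(* A positive deficit keeps the gap below 2P/3, so the column has a lowest point, to which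
   [missing_ge] applies. *)
have hP : h < P by nia.
have := @missing_ge N P s x h.+1 sF (col_gap_in hP) ltac:(lia).
have -> : \sum_(third_lo N <= z < third_hi N | N < x + z) deficit N P s z =
          \sum_((N - x).+1 <= z < third_hi N) deficit N P s z.
  rewrite [RHS](big_nat_widenl _ (third_lo N)); last by rewrite /third_lo; lia.
  by apply: eq_bigl => z /=; lia.
set D := \sum_(_ <= _ < _) deficit _ _ _ _; set c := \sum_(_ <= _ < _) _.
have H : P * \sum_((N - x).+1 <= z < third_hi N) (2 * N - 3 * z)
         <= 3 * N * c + D.
  have cge : \sum_((N - x).+1 <= z < third_hi N) col_missing P s z <= c.
    have [hu|uh] := leqP (third_hi N) (N - x).+1; first by rewrite big_geq.
    have hN : third_hi N <= N.+1 by rewrite /third_hi; lia.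
    rewrite /c [leqRHS](@big_cat_nat _ _ _ (N - x).+1) /=; [|lia..].
    by rewrite [X in _ <= _ + X](@big_cat_nat _ _ _ (third_hi N)) /=; lia.
  apply: leq_trans (leq_add (leq_mul (leqnn _) cge) (leqnn _)).
  rewrite big_distrr [X in X + _]big_distrr -big_split /=.
  apply: leq_sum => z _; rewrite /deficit.
  by have := col_gap_le_missing P s z; nia.
have := @sum_decr_ge N (N - x) ltac:(lia).
move: H few; move: (\sum_(_ <= _ < _) _) (missing _ _ _) => S m.
have -> : 2 * N - 3 * (N - x) = 3 * x - N by lia.
clearbody D c h => H few dec miss.
exact: (deficit_arith Nx xN (ltac:(lia) : h < P) H few dec miss).
Qed.

(** * The missing triangle and its area *)

Lemma missing_lower N P s :
  0 < N -> 0 < P -> sum3_free_rel N P s ->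
  2 * (N * P) <= 9 * missing N P s + 18 * maxn N P.
Proof.
move=> N0 P0 sF; rewrite leqNgt; apply/negP => few.
have few' : 9 * missing P N (transpose_rel s) + 18 * maxn P N < 2 * (P * N).
  by rewrite missing_transpose maxnC [P * N]mulnC.
have K0 := third_eq0 (fun x => @deficit_lt N P s x sF few).
have sF' := sum3_free_rel_transpose sF.
have K0' := third_eq0 (fun x => @deficit_lt P N _ x sF' few').
(* Columns settle x > N/3 and rows settle y > P/3; in the remaining corner a single point already
   forces too many missing ones. *)
have out x y : 1 <= x -> 1 <= y -> 3 * x + 2 <= 2 * N -> 3 * y + 2 <= 2 * P ->
    3 * P * x + 3 * N * y <= 2 * N * P -> ~~ s x y.
  move=> x1 y1 xN yP xy; have [Nx|xN3] := ltnP N (3 * x).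
    have /K0 : third_lo N <= x < third_hi N by rewrite /third_lo /third_hi; lia.
    by rewrite /deficit => Kx; apply: (@notin_col_gap P); nia.
  have [Py|yP3] := ltnP P (3 * y).
    have /K0' : third_lo P <= y < third_hi P by rewrite /third_lo /third_hi; lia.
    rewrite /deficit => Ky; apply: (@notin_col_gap N (transpose_rel s)).
    by move: (col_gap _ _ _) Ky => h Ky; nia.
  apply/negP => sxy; have := missing_ge sF sxy ltac:(lia).
  move: (\sum_(_ <= _ < _) _) (missing _ _ _) few => c m few; nia.
(* The [- 1] secures 3y + 2 <= 2P for y <= [g x]. With the rounding it costs at most 2 points per
   column, hence the 6 N below. *)
pose g x := (2 * N * P - 3 * P * x) %/ (3 * N) - 1.
have gc x : 1 <= x < third_hi N ->
    P * (2 * N - 3 * x) <= 3 * N * col_missing P s x + 6 * N.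
  move=> xA; have xN : 3 * x + 2 <= 2 * N by rewrite /third_hi in xA; lia.
  have N3 : 0 < 3 * N by lia.
  have ge := divn_eq (2 * N * P - 3 * P * x) (3 * N).
  have gr := ltn_pmod (2 * N * P - 3 * P * x) N3.
  have : g x <= col_missing P s x.
    apply: leq_col_missing => [|y yg]; first by rewrite /g; nia.
    by apply: out; rewrite /g in yg; nia.
  by rewrite /g; nia.
have := @sum_decr_ge N 0 ltac:(lia).
set S := \sum_(_ <= _ < _) _.
have H : P * S <= 3 * N * missing N P s + 4 * N * N.
  have cge : \sum_(1 <= x < third_hi N) col_missing P s x <= missing N P s.
    have [h1|h1] := leqP 1 (third_hi N); last by rewrite big_geq //; lia.
    rewrite /missing [leqRHS](@big_cat_nat _ _ _ (third_hi N)) ?leq_addr //=.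
    by rewrite /third_hi; lia.
  have hN : \sum_(1 <= x < third_hi N) 6 * N <= 4 * N * N.
    have : N * (3 * (third_hi N - 1)) <= N * (2 * N).
      by rewrite leq_mul2l /third_hi; apply/orP; right; lia.
    by rewrite sum_nat_const_nat; lia.
  apply: leq_trans (leq_add (leq_mul (leqnn _) cge) hN).
  rewrite /S big_distrr [X in X + _]big_distrr -big_split /=.
  by rewrite big_nat [leqRHS]big_nat; apply: leq_sum => x /gc.
rewrite muln0 subn0 => dec; clearbody S.
move: (missing _ _ _) few H => m few H.
move: (maxn N P) (leq_maxl N P) (leq_maxr N P) few => M NM PM few.
have e1 : P * (2 * N) ^ 2 <= P * (6 * S + 6 * (2 * N)).
  by rewrite leq_mul2l dec orbT.
have e2 : N * (9 * m + 18 * M).+1 <= N * (2 * (N * P)).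
  by rewrite leq_mul2l few orbT.
have e3 : N * N <= N * M by rewrite leq_mul2l NM orbT.
have e4 : N * P <= N * M by rewrite leq_mul2l PM orbT.
(* The errors 24 N N and 12 N P exhaust exactly the 36 N M in twice [e2], which accounts for the
   constant 18. *)
by lia.
Qed.

(** * Back to finite sets *)

(** The bounds are explicit because [inord] sends out-of-range values to 0. *)
Definition set_rel n1 n2 (S : {set 'I_n1.+1 * 'I_n2.+1}) : rel nat :=
  fun x y => [&& x <= n1, y <= n2 & (inord x, inord y) \in S].

Lemma sum3_free_set_rel n1 n2 (S : {set 'I_n1.+1 * 'I_n2.+1}) :
  sum3_free S -> sum3_free_rel n1 n2 (set_rel S).
Proof.
move=> /negP SF x1 y1 x2 y2 x3 y3.
move=> /and3P[x1n y1n S1] /and3P[x2n y2n S2] /and3P[x3n y3n S3] ex ey.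
apply: SF; apply/exists_inP; exists (inord x1, inord y1) => //.
apply/exists_inP; exists (inord x2, inord y2) => //.
apply/exists_inP; exists (inord x3, inord y3) => //=.
by rewrite !inordK // ex ey !eqxx.
Qed.

Lemma card_add_missing n1 n2 (S : {set 'I_n1.+1 * 'I_n2.+1}) :
  S \subset grid n1 n2 -> #|S| + missing n1 n2 (set_rel S) = n1 * n2.
Proof.
move=> /subsetP Sg.
have -> : #|S| = \sum_(1 <= x < n1.+1) \sum_(1 <= y < n2.+1) set_rel S x y.
  transitivity (\sum_(x < n1.+1) \sum_(y < n2.+1) set_rel S x y).
    rewrite pair_bigA /= -sum1_card big_mkcond /=.
    apply: eq_bigr => -[x y] _ /=.
    by rewrite /set_rel !inord_val !leq_ord; case: (_ \in _).
  have z x y : (x == 0) || (y == 0) -> set_rel S x y = false.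
    move=> xy0; apply/negP => /and3P[xn yn /Sg].
    by rewrite inE /= !inordK //; lia.
  rewrite big_ord_recl big1 => [|y _]; last by rewrite z.
  rewrite add0n big_add1 big_mkord; apply: eq_bigr => x _ /=.
  by rewrite big_ord_recl z ?orbT // add0n big_add1 big_mkord.
rewrite /missing /col_missing -big_split /=.
under eq_bigr do rewrite -big_split /=.
under eq_bigr do under eq_bigr do rewrite addnC addn_negb.
by rewrite !sum_nat_const_nat; lia.
Qed.

Local Open Scope ring_scope.

Theorem theorem3p3 (R : realFieldType) :
  exists (C : R) (N : nat), forall n1 n2 : nat,
    (0 < n1)%N -> (0 < n2)%N -> (N <= n1)%N -> (N <= n2)%N ->
    (mu3 n1 n2)%:R <= 7%:R / 9%:R * (n1%:R * n2%:R) + C * (maxn n1 n2)%:R.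
Proof.
(* The constant 2 is 18 / 9, from [missing_lower]. *)
exists 2, 0%N => n1 n2 n1_gt0 n2_gt0 _ _.
suff : (9 * mu3 n1 n2 <= 7 * (n1 * n2) + 18 * maxn n1 n2)%N.
  by rewrite -(ler_nat R) natrD !natrM; lra.
have [S /andP[Sg SF] ->] : {S : {set 'I_n1.+1 * 'I_n2.+1} |
    (S \subset grid n1 n2) && sum3_free S & mu3 n1 n2 = #|S|}.
  apply: eq_bigmax_cond; apply/card_gt0P; exists set0.
  by rewrite unfold_in sub0set; apply/negP => /exists_inP[a]; rewrite inE.
have := missing_lower n1_gt0 n2_gt0 (sum3_free_set_rel SF).
by have := card_add_missing Sg; lia.
Qed.
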